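(* Let $\{x_k\}$ be generated by Algorithm TRishBB applied to $f$. Suppose that: (i) $f:\mathbb{R}^n\to\mathbb{R}$ is continuously differentiable, bounded below by $f_*$, and there is $L>0$ with $f(x)\le f(y)+\nabla f(y)^T(x-y)+\frac{L}{2}\|x-y\|^2$ for all $x,y\in\mathbb{R}^n$; (ii) the Polyak-Lojasiewicz condition holds with some $c\in(0,\infty)$: $2c(f(x)-f_* )\le\|\nabla f(x)\|^2$ for all $x\in\mathbb{R}^n$; (iii) there are positive constants $\omega,M_1,M_2$ such that for all $k$, $\nabla f(x_k)^T\mathbb{E}_k[g_k]\ge\omega\|\nabla f(x_k)\|^2$ and $\mathbb{E}_k[\|g_k\|^2]\le M_1+M_2\|\nabla f(x_k)\|^2$; (iv) $0<\mu_{min}\le\gamma_2\alpha$. Define $h_1=\frac12\sqrt{M_1}$, $h_2=h_1+\sqrt{M_2}$, $\rho=\frac{\mu_{min}}{\alpha\gamma_2}\in(0,1]$, $$\theta_1=\tfrac12\omega\gamma_1-h_2(\gamma_1-\rho\gamma_2),\qquad \theta_2=h_1(\gamma_1\alpha-\mu_{min})+\tfrac12\gamma_1^2LM_1\alpha^2 .$$ Suppose further that, in case $h_2-\frac12\omega>0$, it holds $$\frac{\gamma_1}{\gamma_2}<\frac{\rho h_2}{h_2-\frac12\omega},$$ and that $$\alpha\le\min\left\{\frac{\omega}{\gamma_1LM_2},\ \frac{1}{2c\theta_1}\right\}.$$ Then the expected optimality gap of the iterates satisfies $$\mathbb{E}[f(x_{k+1})]-f_*\ \xrightarrow{k\to\infty}\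 \frac{\theta_2}{2c\,\alpha\,\theta_1}.$$
   Context: Objective: $f(x)=\frac1N\sum_{i=1}^N f_i(x)$ with each $f_i:\mathbb{R}^n\to\mathbb{R}$ continuously differentiable. $\|\cdot\|$ is the Euclidean norm. Algorithm TRishBB: choose an initial $x_0\in\mathbb{R}^n$, constants $\alpha>0$, $0<\gamma_2\le\gamma_1<\infty$, $\mu_{min}>0$, and $\mu_0>0$. At each iteration $k=0,1,2,\dots$: compute a stochastic gradient $g_k\in\mathbb{R}^n$ (a random vector approximating $\nabla f(x_k)$); set $$\Delta_k=\begin{cases}\alpha\gamma_1\|g_k\| & \text{if }\|g_k\|\in[0,\frac1{\gamma_1}),\\ \alpha & \text{if }\|g_k\|\in[\frac1{\gamma_1},\frac1{\gamma_2}],\\ \alpha\gamma_2\|g_k\| & \text{if }\|g_k\|\in(\frac1{\gamma_2},\infty);\end{cases}$$ let $p_k$ be the solution of $\min_{p\in\mathbb{R}^n} m_k(p)=g_k^Tp+\frac{1}{2\mu_k}\|p\|^2$ subject to $\|p\|\le\Delta_k$ (so $p_k=-\mu_kg_k$ if $\|\mu_kg_k\|<\Delta_k$, and $p_k=-\frac{\Delta_k}{\|g_k\|}g_k$ otherwise, with $p_k=0$ if $g_k=0$); set $x_{k+1}=x_k+p_k$; form a parameter $\mu_{k+1}\ge\mu_{min}$. It is assumed that $\mu_k\ge\mu_{min}$ for all $k\ge0$. $\mathbb{E}_k[\cdot]$ is the conditional expectation given that the algorithm has reached $x_k$ at iteration $k$; $\mathbb{E}[\cdot]$ is the expected value taken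 with the joint distribution of all random variables.
   Formalization: The claimed limit of the expected gap is false (f(x)=x²/2 with exact gradients can give gap → 0); instead, for every k, E[f(x_{k+1})]-f_* is bounded above by V+(1-2cαθ1)^{k+1}(f(x_0)-f_*-V), and this bound converges to V=θ2/(2cαθ1). *)

(* Defs.v *)
From HB Require Import structures.
From mathcomp Require Import all_boot all_order all_algebra.
From mathcomp Require Import all_classical all_reals all_analysis.
Export numFieldNormedType.Exports.

Set Implicit Arguments.
Unset Strict Implicit.
Unset Printing Implicit Defensive.

Import Order.TTheory GRing.Theory Num.Theory.
Local Open Scope classical_set_scope.
Local Open Scope ring_scope.

(* The library norm `|v| on 'rV[R]_n is the max norm, so the Euclidean inner
   product and norm are defined here. *)
Definition dot {R : realType} {n : nat} (u v : 'rV[R]_n) : R :=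
  \sum_(i < n) u 0 i * v 0 i.

Definition enorm {R : realType} {n : nat} (u : 'rV[R]_n) : R :=
  Num.sqrt (dot u u).

Definition grad {R : realType} {n : nat} (f : 'rV[R]_n -> R) (x : 'rV[R]_n) :
    'rV[R]_n :=
  \row_(i < n) 'D_(delta_mx 0 i) f x.

Definition continuously_differentiable {R : realType} {n : nat}
    (f : 'rV[R]_n -> R) : Prop :=
  (forall x, differentiable f x) /\ continuous (grad f).

Definition finite_sum_objective {R : realType} {n N : nat}
    (fs : 'I_N -> 'rV[R]_n -> R) (x : 'rV[R]_n) : R :=
  N%:R^-1 * \sum_(i < N) fs i x.

Definition random_vector {d : measure_display} {T : measurableType d}
    {R : realType} {n : nat} (X : T -> 'rV[R]_n) : Prop :=
  forall i : 'I_n, measurable_fun [set: T] (fun w => X w 0 i).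

Definition sigma_of {d : measure_display} {T : measurableType d}
    {R : realType} {n : nat} (X : T -> 'rV[R]_n) : set (set T) :=
  g_sigma_preimage (fun (i : 'I_n) (w : T) => X w 0 i).

(* Y is a version of the conditional expectation of the integrable random
   variable X given the sub-sigma-algebra G (Kolmogorov's definition). *)
Definition is_condexp {d : measure_display} {T : measurableType d}
    {R : realType} (P : probability T R) (G : set (set T)) (X Y : T -> R) :
    Prop :=
  [/\ P.-integrable [set: T] (EFin \o X),
      P.-integrable [set: T] (EFin \o Y),
      forall B : set R, measurable B -> G (Y @^-1` B) &
      forall A : set T, G A ->
        (\int[P]_(w in A) (X w)%:E = \int[P]_(w in A) (Y w)%:E)%E].

Definition is_condexp_vec {d : measure_display} {T : measurableType d}
    {R : realType} {n : nat} (P : probability T R) (G : set (set T))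
    (X Y : T -> 'rV[R]_n) : Prop :=
  forall i : 'I_n, is_condexp P G (fun w => X w 0 i) (fun w => Y w 0 i).

(* The trust-region radius as a function of t = ||g_k||. *)
Definition tr_radius {R : realType} (alpha gamma1 gamma2 t : R) : R :=
  if t < gamma1^-1 then alpha * gamma1 * t
  else if t <= gamma2^-1 then alpha
  else alpha * gamma2 * t.

Definition tr_model {R : realType} {n : nat} (g : 'rV[R]_n) (mu : R)
    (p : 'rV[R]_n) : R :=
  dot g p + (2 * mu)^-1 * enorm p ^+ 2.

Definition solves_tr {R : realType} {n : nat} (g : 'rV[R]_n) (mu Delta : R)
    (p : 'rV[R]_n) : Prop :=
  enorm p <= Delta /\
  forall q : 'rV[R]_n, enorm q <= Delta -> tr_model g mu p <= tr_model g mu q.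

(* A run of the algorithm, as a stochastic process on T.  The objective enters
   only through the assumptions relating the stochastic gradients g k to it.
   The rule updating mu k is left free, as in the algorithm: mu k is any random
   variable bounded below by mumin. *)
Record TRishBB_run {d : measure_display} {T : measurableType d}
    {R : realType} {n : nat} (alpha gamma1 gamma2 mumin mu0 : R)
    (x0 : 'rV[R]_n) (x g p : nat -> T -> 'rV[R]_n) (mu : nat -> T -> R) :
    Prop := {
  run_x_rv : forall k, random_vector (x k);
  run_g_rv : forall k, random_vector (g k);
  run_mu_rv : forall k, measurable_fun [set: T] (mu k);
  run_x_init : forall w, x 0 w = x0;
  run_mu_init : forall w, mu 0 w = mu0;
  run_mu_ge : forall k w, mumin <= mu k w;
  run_p : forall k w,
    solves_tr (g k w) (mu k w)
      (tr_radius alpha gamma1 gamma2 (enorm (g k w))) (p k w);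
  run_x_step : forall k w, x k.+1 w = x k w + p k w
}.

(* Main.v *)
Require Import Defs.
From HB Require Import structures.
From mathcomp Require Import all_boot all_order all_algebra.
From mathcomp Require Import all_classical all_reals all_analysis.
From mathcomp Require Import measurable_realfun.
From mathcomp Require Import ring lra.

(* Every trust-region step is [p_k = - s_k g_k] with a (random) step size
   [s_k] between [mumin] and [gamma1 * alpha].  Writing [A = gamma1 * alpha],
   [G = |grad f(x_k)|] and [N = |g_k|], smoothness gives pointwise
     f(x_{k+1}) <= f(x_k) - A grad f(x_k).g_k + (A - mumin) G N
                   + L A^2 N^2 / 2.
   The moment conditions bound the expectations of the last three terms by
   those of [1] and [G^2], where a conditional expectation is only ever tested
   against [sigma(x_k)]-measurable weights: these may be taken bounded by
   truncation, and bounded weights are uniform limits of step functions.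
   Since [G^2 <= 2 L (f(x_k) - fstar)], integrability propagates along the
   iterates, and the Polyak-Lojasiewicz inequality yields
     E gap_{k+1} <= (1 - 2 c alpha theta1) E gap_k + theta2. *)

Import Order.TTheory GRing.Theory Num.Theory.
Local Open Scope classical_set_scope.
Local Open Scope ring_scope.

(** * Euclidean geometry and the trust-region step *)

Section euclidean.
Context {R : realType} {n : nat}.
Implicit Types u v w : 'rV[R]_n.

Lemma dotC u v : dot u v = dot v u.
Proof. by apply: eq_bigr => i _; rewrite mulrC. Qed.

Lemma dotDl u v w : dot (u + v) w = dot u w + dot v w.
Proof. by rewrite -big_split; apply: eq_bigr => i _; rewrite mxE mulrDl. Qed.

Lemma dotZl (a : R) u v : dot (a *: u) v = a * dot u v.
Proof. by rewrite mulr_sumr; apply: eq_bigr => i _; rewrite mxE mulrA. Qed.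

Lemma dotDr u v w : dot u (v + w) = dot u v + dot u w.
Proof. by rewrite dotC dotDl !(dotC u). Qed.

Lemma dotZr (a : R) u v : dot u (a *: v) = a * dot u v.
Proof. by rewrite dotC dotZl (dotC u). Qed.

Lemma dot_ge0 u : 0 <= dot u u.
Proof. by apply: sumr_ge0 => i _; exact: sqr_ge0. Qed.

Lemma dot_eq0 u : dot u u <= 0 -> u = 0.
Proof.
move=> u0; apply/rowP => i; rewrite mxE; apply/eqP.
rewrite -sqrf_eq0 eq_le sqr_ge0 andbT (le_trans _ u0)//.
rewrite /dot (bigD1 i)//= expr2 lerDl.
by apply: sumr_ge0 => j _; exact: sqr_ge0.
Qed.

Lemma enorm_ge0 u : 0 <= enorm u. Proof. exact: sqrtr_ge0. Qed.

Lemma sqr_enorm u : enorm u ^+ 2 = dot u u.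
Proof. by rewrite sqr_sqrtr// dot_ge0. Qed.

Lemma enorm_eq0 u : enorm u <= 0 -> u = 0.
Proof.
move=> u0; apply: dot_eq0; rewrite -sqr_enorm.
have -> : enorm u = 0 by apply/eqP; rewrite eq_le u0 enorm_ge0.
by rewrite expr0n.
Qed.

Lemma enormZ (a : R) u : enorm (a *: u) = `|a| * enorm u.
Proof.
by rewrite /enorm dotZl dotZr mulrA -expr2 sqrtrM ?sqr_ge0// sqrtr_sqr.
Qed.

(** For [v] nonzero, expand the nonnegative squared norm of [dot v v *: u - dot u v *: v] and divide
    by [dot v v]. *)
Lemma cauchy_schwarz u v : `|dot u v| <= enorm u * enorm v.
Proof.
rewrite -ler_sqr ?nnegrE ?mulr_ge0 ?enorm_ge0// real_normK ?num_real//.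
rewrite exprMn !sqr_enorm.
have [v0|v0] := leP (dot v v) 0.
  by rewrite (dot_eq0 _ v0) -(scale0r 0) !dotZr !mul0r mulr0 expr0n.
have := dot_ge0 (dot v v *: u + (- dot u v) *: v).
rewrite !(dotDl, dotDr, dotZl, dotZr) (dotC v u) => h.
have {h} : 0 <= dot v v * (dot u u * dot v v - dot u v ^+ 2) by nra.
by rewrite pmulr_rge0// subr_ge0.
Qed.

End euclidean.

Section trust_region.
Context {R : realType} {n : nat}.
Variables (alpha gamma1 gamma2 : R).
Hypotheses (alpha0 : 0 < alpha) (gamma20 : 0 < gamma2).
Hypothesis gamma21 : gamma2 <= gamma1.

Let gamma10 : 0 < gamma1. Proof. exact: lt_le_trans gamma20 _. Qed.

(** In the outer branches one bound is an equality and the other is [gamma2 <= gamma1]; in the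
    middle branch [gamma2 * t <= 1 <= gamma1 * t]. *)
Lemma tr_radius_bounds (t : R) : 0 <= t ->
  alpha * gamma2 * t <= tr_radius alpha gamma1 gamma2 t <= alpha * gamma1 * t.
Proof.
move=> t0; rewrite /tr_radius.
have g12 : alpha * gamma2 * t <= alpha * gamma1 * t.
  by rewrite ler_wpM2r// ler_wpM2l// ltW.
have [t1|t1] := ltP t gamma1^-1; first by rewrite g12 lexx.
have [t2|t2] := leP t gamma2^-1; last by rewrite g12 lexx.
have g1t : 1 <= gamma1 * t by rewrite -ler_pdivrMl// mulr1.
have g2t : gamma2 * t <= 1 by rewrite -ler_pdivlMl// mulr1.
by rewrite -!mulrA ler_piMr ?ler_peMr// ltW.
Qed.

(* The model is [mu^-1]-strongly convex, so it suffices that [q = - s *: g]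
   satisfies the first-order optimality condition on the ball. *)
Lemma solves_tr_unique (g p : 'rV[R]_n) (mu Delta s : R) :
  0 < mu -> 0 <= s <= mu -> s * enorm g <= Delta ->
  s = mu \/ s * enorm g = Delta ->
  solves_tr g mu Delta p -> p = - s *: g.
Proof.
move=> mu0 /andP[s0 smu] feas act [pD /(_ (- s *: g))].
rewrite enormZ normrN ger0_norm// => /(_ feas).
rewrite /tr_model enormZ normrN ger0_norm// exprMn !sqr_enorm dotZr => le_m.
apply/eqP; rewrite -subr_eq0; apply/eqP; apply: dot_eq0.
rewrite -scaleNr opprK !(dotDl, dotDr, dotZl, dotZr) (dotC p g).
(* If the constraint is active, Cauchy-Schwarz gives [dot g p >= - enorm g * Delta = - s * dot g
   g]. *)
have foc : 0 <= (mu - s) * (dot g p + s * dot g g).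
  case: act => [->|act]; first by rewrite subrr mul0r.
  rewrite mulr_ge0 ?subr_ge0//.
  have := cauchy_schwarz g p; rewrite ler_norml => /andP[+ _].
  have := ler_wpM2l (enorm_ge0 g) pD.
  by rewrite -act -sqr_enorm; nra.
(* Clearing the denominator and using [foc] bounds the squared norm of [p + s *: g] by [- 2 * (mu -
   s) * (dot g p + s * dot g g) <= 0]. *)
have {}le_m : 2 * mu * (dot g p + (2 * mu)^-1 * dot p p)
    <= 2 * mu * (- s * dot g g + (2 * mu)^-1 * (s ^+ 2 * dot g g)).
  by rewrite ler_pM2l// mulr_gt0.
rewrite !mulrDr !mulVKf ?gt_eqF ?mulr_gt0// in le_m.
by nra.
Qed.

Lemma solves_tr_step (g p : 'rV[R]_n) (mumin mu : R) :
  0 < mumin -> mumin <= mu -> mumin <= gamma2 * alpha ->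
  solves_tr g mu (tr_radius alpha gamma1 gamma2 (enorm g)) p ->
  exists2 s, mumin <= s <= gamma1 * alpha & p = - s *: g.
Proof.
move=> m0 mmu mga solp.
have /andP[lo hi] := tr_radius_bounds _ (enorm_ge0 g).
set D := tr_radius _ _ _ _ in solp lo hi.
have mu0 : 0 < mu by exact: lt_le_trans m0 _.
have ga : gamma2 * alpha <= gamma1 * alpha by rewrite ler_pM2r.
have [g0|g0] := leP (enorm g) 0.
  have eg : enorm g = 0 by apply/eqP; rewrite eq_le g0 enorm_ge0.
  (* When [g = 0] the radius vanishes and forces [p = 0], so any size in the range serves. *)
  exists mumin; first by rewrite lexx (le_trans mga).
  rewrite (enorm_eq0 _ g0) scaler0; apply: enorm_eq0.
  by case: solp => + _ => /le_trans; apply; rewrite (le_trans hi)// eg mulr0.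
have dlo : gamma2 * alpha <= D / enorm g.
  by rewrite ler_pdivlMr// (mulrC gamma2).
have dhi : D / enorm g <= gamma1 * alpha.
  by rewrite ler_pdivrMr// (mulrC gamma1).
(* The step size is the unconstrained one, cut down to reach the boundary of the ball; [dlo] and
   [dhi] place the cut inside the range. *)
exists (Num.min mu (D / enorm g)).
  by rewrite le_min mmu (le_trans mga)//= ge_min dhi orbT.
have [muD|Dmu] := leP mu (D / enorm g).
  apply: solves_tr_unique solp => //; last by left.
    by rewrite lexx ltW.
  by rewrite -ler_pdivlMr.
have eD : D / enorm g * enorm g = D by rewrite divfK// gt_eqF.
apply: solves_tr_unique solp => //; last by right.
  by rewrite (ltW Dmu) andbT (le_trans _ dlo)// (le_trans (ltW m0)).
by rewrite eD.
Qed.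

End trust_region.

(** * Consequences of smoothness: gradient bound and pointwise descent *)

Section smooth.
Context {R : realType} {n : nat}.
Variables (f : 'rV[R]_n -> R) (fstar L : R).
Hypothesis L0 : 0 < L.
Hypothesis fstar_le : forall y, fstar <= f y.
Hypothesis smooth : forall y z,
  f y <= f z + dot (grad f z) (y - z) + L / 2 * enorm (y - z) ^+ 2.

(** A gradient step of length [L^-1] from [y] lowers [f] by at least
    [enorm (grad f y) ^+ 2 / (2 * L)], and the value reached is still at least [fstar]. *)
Lemma sqr_enorm_grad_le y : enorm (grad f y) ^+ 2 <= 2 * L * (f y - fstar).
Proof.
have := le_trans (fstar_le _) (smooth (y + (- L^-1) *: grad f y) y).
rewrite (addrC y) addrK enormZ normrN gtr0_norm ?invr_gt0// exprMn dotZr.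
rewrite -sqr_enorm; set G := _ ^+ 2.
have -> : L / 2 * (L^-1 ^+ 2 * G) = L^-1 * G / 2.
  by field; rewrite gt_eqF.
move=> h; have {h} : L^-1 * G <= 2 * (f y - fstar) by lra.
by rewrite mulrC ler_pdivrMr// => h; lra.
Qed.

(** The step size [s] may depend on [g], so it is replaced by the constant [A] before taking
    expectations; Cauchy-Schwarz with [A - s <= A - m] controls the error in the linear term. *)
Lemma step_le (g : 'rV[R]_n) (m A s : R) y : 0 <= m -> m <= s <= A ->
  f (y + (- s) *: g) <= f y - A * dot (grad f y) g
    + (A - m) * (enorm (grad f y) * enorm g) + L / 2 * A ^+ 2 * enorm g ^+ 2.
Proof.
move=> m0 /andP[ms sA]; apply: (le_trans (smooth _ y)).
rewrite (addrC y) addrK enormZ normrN ger0_norm ?(le_trans m0)//.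
rewrite dotZr exprMn.
have : s ^+ 2 * enorm g ^+ 2 <= A ^+ 2 * enorm g ^+ 2.
  rewrite ler_wpM2r ?sqr_ge0// ler_sqr ?nnegrE ?(le_trans m0)//.
  exact: le_trans ms _.
move=> /(ler_wpM2l (ltW L0)).
have := cauchy_schwarz (grad f y) g; rewrite ler_norml => /andP[lo hi].
have : (A - s) * dot (grad f y) g <= (A - m) * (enorm (grad f y) * enorm g).
  have pg : 0 <= enorm (grad f y) * enorm g by rewrite mulr_ge0 ?enorm_ge0.
  by nra.
by rewrite -mulrA; nra.
Qed.

End smooth.

(** * Measurability and integrals *)

Section random_vectors.
Context {d : measure_display} {T : measurableType d} {R : realType} {n : nat}.
Implicit Types (X : T -> 'rV[R]_n) (phi : 'rV[R]_n -> R).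

(** An open set is the countable union of the rational boxes it contains: around each point,
    rational corners are picked within [e] in every coordinate. Preimages of boxes are finite
    intersections of coordinate preimages. *)
Lemma random_vector_open X (U : set 'rV[R]_n) :
  random_vector X -> open U -> measurable (X @^-1` U).
Proof.
move=> mX oU.
pose box (p : 'rV[rat]_n * 'rV[rat]_n) : set 'rV[R]_n :=
  [set y | forall i, ratr (p.1 0 i) < y 0 i < ratr (p.2 0 i)].
have -> : X @^-1` U = \bigcup_p (if `[< box p `<=` U >] then X @^-1` box p
                                 else set0).
  apply/seteqP; split=> [w Uw|w [p _]]; last by case: asboolP => // pU /pU.
  have [e /= e0 eU] : exists2 e, 0 < e & ball (X w) e `<=` U.
    by apply/nbhs_ballP; apply: open_nbhs_nbhs.
  have lt_l i : X w 0 i - e < X w 0 i by rewrite gtrBl.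
  have lt_r i : X w 0 i < X w 0 i + e by rewrite ltrDl.
  pose a := \row_i sval (cid (rat_in_itvoo (lt_l i))).
  pose b := \row_i sval (cid (rat_in_itvoo (lt_r i))).
  exists (a, b) => //; rewrite asboolT /box /=.
    move=> i; rewrite !mxE; case: cid => q /= /andP[].
    by case: cid => r /= /andP[]; rewrite !bnd_simp => -> _ _ ->.
  move=> y /= yab; apply: eU; split=> // i j; rewrite ord1.
  have := yab j; rewrite !mxE; case: cid => q /=; case: cid => r /=.
  rewrite !in_itv/= => /andP[? ?] /andP[? ?] /andP[? ?].
  by rewrite /ball/= ltr_norml; apply/andP; split; lra.
apply: countable_bigcupT_measurable => // p.
case: asboolP => _ //.
have -> : X @^-1` box p = \bigcap_(i in [set: 'I_n])
    ((fun w => X w 0 i) @^-1` `]ratr (p.1 0 i), ratr (p.2 0 i)[).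
  by apply/seteqP; split=> w /= h i; [move=> _|]; rewrite ?in_itv/=;
    [exact: h|have := h i I; rewrite /= in_itv].
apply: fin_bigcap_measurable => // i _.
by rewrite -[X in measurable X]setTI; apply: mX.
Qed.

Lemma measurable_continuous_comp X phi :
  random_vector X -> continuous phi -> measurable_fun setT (phi \o X).
Proof.
move=> mX /continuousP cphi; apply: (measurability _ (RGenOpens.measurableE R)).
move=> _ [_ [a [b ->] <-]]; rewrite setTI comp_preimage.
by apply: random_vector_open => //; apply: cphi; exact: interval_open.
Qed.

(* [sigma_of X] is convertible to [<<s coordinate_preimages X >>], which
   makes [g_sigma_algebraType] available for it. *)
Definition coordinate_preimages X : set (set T) :=
  \big[setU/set0]_(i < n)
    preimage_set_system setT (fun w => X w 0 i) measurable.

Lemma sigma_of_sub X : random_vector X -> sigma_of X `<=` measurable.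
Proof.
move=> mX; apply: smallest_sub; first exact: sigma_algebra_measurable.
rewrite -bigcup_seq => A [i _ [B mB <-]]; exact: mX.
Qed.

End random_vectors.

Section sigma_of.
Context {d : measure_display} {T : measurableType d} {R : realType} {n : nat}.
Variable X : T -> 'rV[R]_n.

(** Makes continuous functions of [X] admissible as weights in integrals tested against
    [sigma_of X]. *)
Lemma random_vector_sigma_of :
  random_vector (X : g_sigma_algebraType (coordinate_preimages X) -> 'rV[R]_n).
Proof.
move=> i _ B mB; apply: sub_sigma_algebra; rewrite /coordinate_preimages.
by rewrite -bigcup_seq; exists i; [rewrite /= mem_index_enum|exists B].
Qed.

End sigma_of.

(** * Integrability and integrals of real random variables *)

Section expectation_tools.
Context {d : measure_display} {T : measurableType d} {R : realType}.
Variable P : probability T R.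
Implicit Types X Y : T -> R.

Notation integr X := (P.-integrable setT (EFin \o X)).

Lemma integrable_le X Y : measurable_fun setT X -> (forall w, `|X w| <= Y w) ->
  integr Y -> integr X.
Proof.
move=> mX XY iY; apply: le_integrable iY => //; first exact/measurable_EFinP.
by move=> w _; rewrite /= lee_fin (le_trans (XY w))// ler_norm.
Qed.

Lemma integrable_addr X Y : integr X -> integr Y -> integr (fun w => X w + Y w).
Proof.
move=> iX iY; rewrite (_ : _ \o _ = (EFin \o X) \+ (EFin \o Y))%E//.
exact: integrableD.
Qed.

Lemma integrable_subr X Y : integr X -> integr Y -> integr (fun w => X w - Y w).
Proof.
move=> iX iY; rewrite (_ : _ \o _ = (EFin \o X) \- (EFin \o Y))%E//.
exact: integrableB.
Qed.

Lemma integrable_scaler (a : R) X : integr X -> integr (fun w => a * X w).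
Proof. by move=> iX; exact: (integrableZl _ _ iX). Qed.

Lemma integrable_cstr (a : R) : integr (fun=> a).
Proof. exact: finite_measure_integrable_cst. Qed.

Lemma integrable_sumr (I : finType) (X : I -> T -> R) :
  (forall i, integr (X i)) -> integr (fun w => \sum_i X i w).
Proof.
move=> iX.
rewrite (_ : _ \o _ = fun w => \sum_i (X i w)%:E)%E; last first.
  by apply/funext => w /=; rewrite sumEFin.
by apply: integrable_sum => // i _; exact: iX.
Qed.

Lemma Rintegral_sumr (I : finType) (X : I -> T -> R) :
  (forall i, integr (X i)) ->
  \int[P]_w (\sum_i X i w) = \sum_i \int[P]_w X i w.
Proof.
move=> iX; rewrite /Rintegral.
under eq_integral do rewrite -sumEFin.
rewrite integral_sum//= sum_fine// => i _.
by apply: integrable_fin_num => //; exact: iX.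
Qed.

Lemma integrable_boundedM (K : R) X Y : measurable_fun setT X ->
  (forall w, `|X w| <= K) -> integr Y -> integr (fun w => X w * Y w).
Proof.
move=> mX XK iY; apply: (integrable_le _ (fun w => K * `|Y w|)).
- apply: measurable_funM => //.
  by apply/measurable_EFinP; exact: measurable_int iY.
- by move=> w; rewrite normrM ler_wpM2r.
- by apply: integrable_scaler; exact: integrable_norm.
Qed.

(** [X] agrees almost everywhere with its positive part. *)
Lemma Rintegral_ae_ge0 X : integr X -> {ae P, forall w, 0 <= X w} ->
  0 <= \int[P]_w X w.
Proof.
move=> iX X0.
have mX : measurable_fun setT (EFin \o X) by exact: measurable_int iX.
have -> : \int[P]_w X w = \int[P]_w Num.max (X w) 0.
  congr fine; apply: ae_eq_integral => //.
    apply/measurable_EFinP; apply: measurable_maxr => //.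
    exact/measurable_EFinP.
  by apply: filterS X0 => w /= w0 _; rewrite (max_idPl w0).
by apply: Rintegral_ge0 => w _; rewrite le_max lexx orbT.
Qed.

End expectation_tools.

(** * Testing conditional expectations against measurable weights *)

Section orthogonality.
Context {d : measure_display} {T : measurableType d} {R : realType}.
Variables (P : probability T R) (G : set (set T)).
Hypothesis subG : <<s G >> `<=` measurable.

Local Notation TG := (g_sigma_algebraType G).
Local Notation integr X := (P.-integrable setT (EFin \o X)).

Lemma sub_measurable_fun (Z : T -> R) :
  measurable_fun setT (Z : TG -> R) -> measurable_fun setT Z.
Proof. by move=> mZ mT B mB; apply: subG; exact: mZ. Qed.

(** The sum counts the integers from 1 to [m] not exceeding [y], so it is the integer part of
    [y]. *)
Lemma sum_threshold (m : nat) (y : R) : 0 <= y <= m%:R ->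
  y - 1 <= \sum_(j < m) (j.+1%:R <= y)%R%:R <= y.
Proof.
move=> /andP[y0 ym].
have key (k : nat) : (k%:R <= y -> \sum_(j < k) (j.+1%:R <= y)%R%:R = k%:R :> R)
    /\ (y <= k%:R -> y - 1 <= \sum_(j < k) (j.+1%:R <= y)%R%:R <= y).
  elim: k => [|k [IHle IHge]].
    split=> [_|yk]; rewrite big_ord0// y0 andbT; lra.
  rewrite big_ord_recr/=; split=> [yk|yk].
    by rewrite yk IHle ?natr1 ?(le_trans _ yk) ?ler_nat.
  have [yk'|yk'] := leP y k%:R.
    have [ky|ky] := leP k.+1%:R y; last by rewrite addr0 IHge.
    by have := le_trans ky yk'; rewrite ler_nat ltnn.
  rewrite (IHle (ltW yk')) -natr1 in yk *.
  by have [ky|ky] := leP (k%:R + 1) y; apply/andP; split; rewrite /=; lra.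
exact: (key m).2.
Qed.

(** [Z] is rounded down to multiples of [m.+1%:R^-1]. The rounded weight is a combination of
    indicators of level sets in [<<s G>>], hence integrates to 0 against [D]; the rounding error
    costs at most [N / m.+1]. *)
Lemma Rintegral_orthogonal_unit (Z D : T -> R) :
  integr D -> (forall A, <<s G >> A -> \int[P]_(w in A) D w = 0) ->
  measurable_fun setT (Z : TG -> R) -> (forall w, 0 <= Z w <= 1) ->
  \int[P]_w (Z w * D w) = 0.
Proof.
move=> iD D0 mZ Z01.
have mZT := sub_measurable_fun _ mZ.
have iZD : integr (fun w => Z w * D w).
  apply: (integrable_boundedM _ 1) => // w.
  by rewrite ler_norml; have := Z01 w; lra.
pose N := \int[P]_w `|D w|.
have bound (m : nat) : `|\int[P]_w (Z w * D w)| <= m.+1%:R^-1 * N.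
  pose A (j : 'I_m.+1) : set T := [set w | j.+1%:R <= m.+1%:R * Z w].
  have GA j : <<s G >> (A j).
    have : measurable_fun setT (fun w : TG => j.+1%:R <= m.+1%:R * Z w).
      by apply: measurable_fun_ler => //; apply: measurable_funM.
    move=> /(_ measurableT [set true]); rewrite setTI; exact.
  pose S w := \sum_(j < m.+1) m.+1%:R^-1 * (\1_(A j) w * D w).
  have iA j : integr (fun w => \1_(A j) w * D w).
    apply: (integrable_boundedM _ 1) => //.
      by apply: measurable_indic; apply: subG.
    by move=> w; rewrite indicE; case: (_ \in _); rewrite /= ?normr1 ?normr0.
  have iS : integr S.
    by apply: integrable_sumr => j; exact: integrable_scaler.
  have S0 : \int[P]_w S w = 0.
    rewrite Rintegral_sumr; last by move=> j; exact: integrable_scaler.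
    apply: big1 => j _; rewrite RintegralZl//.
    rewrite [X in _ * X](_ : _ = 0) ?mulr0// -(D0 _ (GA j)).
    rewrite [RHS]Rintegral_mkcond.
    apply: eq_Rintegral => w _; rewrite indicE /patch.
    by case: ifP => _; rewrite ?mul1r ?mul0r.
  have -> : \int[P]_w (Z w * D w) = \int[P]_w (Z w * D w - S w).
    by rewrite RintegralB// S0 subr0.
  apply: le_trans (le_normr_Rintegral _ _) _ => //.
    exact: integrable_subr.
  rewrite -RintegralZl//; last exact: integrable_norm.
  apply: le_Rintegral => //.
  - by apply: integrable_norm; exact: integrable_subr.
  - by apply: integrable_scaler; exact: integrable_norm.
  move=> w _; rewrite /S -mulr_sumr -mulr_suml mulrA -mulrBl normrM.
  rewrite ler_wpM2r//.
  have /andP[z0 z1] := Z01 w.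
  have mz : 0 <= m.+1%:R * Z w <= m.+1%:R.
    by rewrite mulr_ge0// ler_piMr.
  have /andP[lo hi] := sum_threshold _ _ mz.
  have -> : \sum_(j < m.+1) \1_(A j) w
      = \sum_(j < m.+1) (j.+1%:R <= m.+1%:R * Z w)%R%:R :> R.
    by apply: eq_bigr => j _; rewrite indicE; congr (nat_of_bool _)%:R;
      apply/idP/idP; rewrite inE.
  set s := \sum_(j < _) _ in lo hi *.
  have -> : Z w - m.+1%:R^-1 * s = m.+1%:R^-1 * (m.+1%:R * Z w - s).
    by rewrite mulrBr mulKf// pnatr_eq0.
  rewrite normrM gtr0_norm ?invr_gt0// ler_piMr//.
  by rewrite ler_norml; lra.
apply/eqP; rewrite -normr_eq0 eq_le normr_ge0 andbT.
rewrite leNgt; apply/negP => I0.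
(* For this [m], [m.+1] exceeds [N] divided by the absolute value of the integral, contradicting
   [bound]. *)
have := bound (Num.truncn (N / `|\int[P]_w (Z w * D w)|)).
by rewrite leNgt mulrC ltr_pdivrMr// mulrC -ltr_pdivrMr// truncnS_gt.
Qed.

(** An affine map sends [[-K, K]] onto [[0, 1]]; the constant it introduces integrates to 0 because
    the whole space belongs to [<<s G>>]. *)
Lemma Rintegral_orthogonal (K : R) (Z D : T -> R) :
  integr D -> (forall A, <<s G >> A -> \int[P]_(w in A) D w = 0) ->
  measurable_fun setT (Z : TG -> R) -> (forall w, `|Z w| <= K) ->
  \int[P]_w (Z w * D w) = 0.
Proof.
move=> iD D0 mZ ZK.
wlog K0 : K ZK / 0 < K.
  move=> /(_ (`|K| + 1)); apply; last by rewrite ltr_wpDl.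
  by move=> w; rewrite (le_trans (ZK w))// (le_trans (ler_norm K))// lerDl.
pose Z1 w := (2 * K)^-1 * (Z w + K).
have mZ1 : measurable_fun setT (Z1 : TG -> R).
  by apply: measurable_funM => //; apply: measurable_funD.
have Z101 w : 0 <= Z1 w <= 1.
  have := ZK w; rewrite ler_norml => /andP[lo hi].
  rewrite /Z1 mulrC divr_ge0 ?ler_pdivrMr; [|lra|lra|lra].
  by rewrite /=; lra.
have iZ1 : integr (fun w => Z1 w * D w).
  apply: (integrable_boundedM _ 1) => //; first exact: sub_measurable_fun.
  by move=> w; rewrite ler_norml; have := Z101 w; lra.
have ZE w : Z w * D w = 2 * K * (Z1 w * D w) - K * D w.
  by rewrite /Z1; field; rewrite gt_eqF.
under eq_Rintegral do rewrite ZE.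
rewrite RintegralB ?RintegralZl//; [|exact: integrable_scaler..].
rewrite Rintegral_orthogonal_unit// D0 ?mulr0 ?subrr//.
exact: (@measurableT _ TG).
Qed.

(** Each outcome eventually enters the truncation event, and the norm of [W] dominates, so the
    truncated integrals converge to the full one. *)
Lemma Rintegral_truncation_ge0 (zeta W : T -> R) :
  measurable_fun setT zeta -> integr W ->
  (forall m : nat, 0 <= \int[P]_w (\1_[set w | zeta w <= m%:R] w * W w)) ->
  0 <= \int[P]_w W w.
Proof.
move=> mz iW pos.
have mA (m : nat) : measurable [set w | zeta w <= m%:R].
  have : measurable_fun setT (fun w => zeta w <= m%:R).
    exact: measurable_fun_ler.
  by move=> /(_ measurableT [set true]); rewrite setTI; exact.
pose h m w := \1_[set w | zeta w <= m%:R] w * W w.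
have mW : measurable_fun setT W.
  by apply/measurable_EFinP; exact: measurable_int iW.
have ih m : integr (h m).
  apply: (integrable_boundedM _ 1 (\1_[set w | zeta w <= m%:R])) => //.
  by move=> w; rewrite indicE; case: (_ \in _); rewrite /= ?normr1 ?normr0.
have [| | | | |_ _ cv] := @dominated_convergence _ _ _ P setT measurableT
  (fun m => EFin \o h m) (EFin \o W) (EFin \o (fun w => `|W w|)).
- by move=> m; exact: measurable_int (ih m).
- exact: measurable_int iW.
- apply: aeW => w _; apply: cvg_near_cst; near=> m.
  rewrite /h /= indicE mem_set ?mul1r//=.
  by near: m; exact: nbhs_infty_ger.
- exact: integrable_norm.
- apply: aeW => w m _; rewrite /h /= lee_fin normrM ler_piMl//.
  by rewrite indicE; case: (_ \in _); rewrite /= ?normr1 ?normr0.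
rewrite -lee_fin /Rintegral fineK; last exact: integrable_fin_num.
rewrite -(cvg_lim (@ereal_hausdorff R) cv).
apply: lime_ge; first by apply/cvg_ex; eexists; exact: cv.
apply: nearW => m /=.
rewrite -[leRHS]fineK; last by apply: integrable_fin_num => //; exact: ih.
by rewrite lee_fin; exact: pos.
Unshelve. all: by end_near. Qed.

Lemma condexp_orthogonal (X Y : T -> R) : is_condexp P <<s G >> X Y ->
  forall A, <<s G >> A -> \int[P]_(w in A) (X w - Y w) = 0.
Proof.
move=> [iX iY _ XY] A GA; have mA := subG _ GA.
rewrite RintegralB//; [|exact: integrableS measurableT mA _ _..].
by rewrite /Rintegral XY// subrr.
Qed.

(** On the event where the sum [zeta] of the absolute weights is at most [m], every weight is
    bounded, so [X i] may be exchanged for [Y i] term by term. The truncation is then removed for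
    the sum as a whole, the level at which integrability is assumed. *)
Lemma condexp_weighted_ge (I : finType) (Z X Y : I -> T -> R) (V : T -> R) :
  (forall i, is_condexp P <<s G >> (X i) (Y i)) ->
  (forall i, measurable_fun setT (Z i : TG -> R)) ->
  {ae P, forall w, V w <= \sum_i Z i w * Y i w} ->
  integr V -> integr (fun w => \sum_i Z i w * X i w) ->
  \int[P]_w V w <= \int[P]_w \sum_i Z i w * X i w.
Proof.
move=> XY mZ VY iV iS; rewrite -subr_ge0 -RintegralB//.
pose zeta w := \sum_i `|Z i w|.
have mzeta : measurable_fun setT (zeta : TG -> R).
  apply: measurable_sum => i.
  exact: (@measurableT_comp _ _ _ _ _ _ (@Num.Def.normr R R)).
apply: (Rintegral_truncation_ge0 zeta).
- exact: sub_measurable_fun.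
- exact: integrable_subr.
move=> m; pose h : T -> R := \1_[set w | zeta w <= m%:R].
have mh : measurable_fun setT (h : TG -> R).
  apply: measurable_indic.
  have : measurable_fun setT (fun w : TG => zeta w <= m%:R).
    exact: measurable_fun_ler.
  by move=> /(_ measurableT [set true]); rewrite setTI; exact.
have h01 w : `|h w| <= 1.
  by rewrite /h indicE; case: (_ \in _); rewrite /= ?normr1 ?normr0.
have h0 w : 0 <= h w by rewrite /h indicE.
have mhZ i : measurable_fun setT ((fun w => h w * Z i w) : TG -> R).
  exact: measurable_funM.
have hZ i w : `|h w * Z i w| <= m%:R.
  rewrite /h indicE; have [|_] := boolP (w \in _); last by rewrite mul0r normr0.
  rewrite inE /= mul1r; apply: le_trans.
  by rewrite /zeta (bigD1 i)//= lerDl sumr_ge0.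
have iX i : integr (X i) by have [] := XY i.
have iY i : integr (Y i) by have [] := XY i.
pose D i w := h w * Z i w * (X i w - Y i w).
pose U w := \sum_i h w * Z i w * Y i w - h w * V w.
have iD i : integr (D i).
  apply: integrable_boundedM (hZ i) _; first exact: sub_measurable_fun.
  exact: integrable_subr.
have iU : integr U.
  apply: integrable_subr.
    apply: integrable_sumr => i.
    by apply: integrable_boundedM (hZ i) _; first exact: sub_measurable_fun.
  by apply: integrable_boundedM h01 _; first exact: sub_measurable_fun.
(* Each [D i] integrates to 0 by orthogonality, and [U] is almost everywhere nonnegative by the
   bound on [V]. *)
have E w : h w * (\sum_i Z i w * X i w - V w) = \sum_i D i w + U w.
  rewrite /D /U addrA -big_split/= mulrBr mulr_sumr; congr (_ - _).
  by apply: eq_bigr => i _; rewrite mulrBr subrK mulrA.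
under eq_Rintegral do rewrite -/(h _) E.
rewrite RintegralD//; last exact: integrable_sumr.
rewrite Rintegral_sumr// big1 ?add0r; last first.
  move=> i _; apply: (Rintegral_orthogonal m%:R) => //.
  - exact: integrable_subr.
  - exact: condexp_orthogonal.
apply: Rintegral_ae_ge0 => //; apply: filterS VY => w VY.
rewrite /U subr_ge0; under eq_bigr do rewrite -mulrA.
by rewrite -mulr_sumr ler_wpM2l.
Qed.

End orthogonality.

Lemma Rintegral_affine {d : measure_display} {T : measurableType d}
    {R : realType} (P : probability T R) (a b : R) (X : T -> R) :
  P.-integrable setT (EFin \o X) ->
  \int[P]_w (a + b * X w) = a + b * \int[P]_w X w.
Proof.
move=> iX.
rewrite RintegralD//; [|exact: integrable_cstr|exact: integrable_scaler].
rewrite RintegralZl// Rintegral_cst//.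
have /(congr1 fine) -> := @probability_setT _ _ _ P.
by rewrite mulr1.
Qed.

Section condexp_single.
Context {d : measure_display} {T : measurableType d} {R : realType}.
Variables (P : probability T R) (G : set (set T)).
Hypothesis subG : <<s G >> `<=` measurable.

(** The case of one summand of [condexp_weighted_ge], with [- Z] and [- V]. *)
Lemma condexp_weighted_le (Z X Y V : T -> R) : is_condexp P <<s G >> X Y ->
  measurable_fun setT (Z : g_sigma_algebraType G -> R) ->
  {ae P, forall w, Z w * Y w <= V w} ->
  P.-integrable setT (EFin \o V) ->
  P.-integrable setT (EFin \o (fun w => Z w * X w)) ->
  \int[P]_w (Z w * X w) <= \int[P]_w V w.
Proof.
move=> XY mZ YV iV iZX.
have nI U : P.-integrable setT (EFin \o U) ->
    \int[P]_w (- U w) = - \int[P]_w U w.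
  move=> iU; under eq_Rintegral do rewrite -mulN1r.
  by rewrite RintegralZl// mulN1r.
have E w : \sum_(i < 1) - Z w * X w = - (Z w * X w) by rewrite big_ord1 mulNr.
rewrite -lerN2 -!nI//; under [leRHS]eq_Rintegral do rewrite -E.
apply: (condexp_weighted_ge _ _ subG _ _ _ (fun=> Y)) => //.
- move=> _; apply: (@measurableT_comp _ _ _ _ _ _ (@GRing.opp R)) => //.
- by apply: filterS YV => w YV; rewrite big_ord1 mulNr lerN2.
- by under [X in EFin \o X]eq_fun do rewrite -mulN1r; exact: integrable_scaler.
- under [X in EFin \o X]eq_fun do rewrite E -mulN1r; exact: integrable_scaler.
Qed.

End condexp_single.

(** * Measurability of inner products, norms and gradients *)

Section measurability.
Context {d : measure_display} {T : measurableType d} {R : realType} {n : nat}.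
Implicit Types X Y : T -> 'rV[R]_n.

Lemma measurable_dot X Y : random_vector X -> random_vector Y ->
  measurable_fun setT (fun w => dot (X w) (Y w)).
Proof.
by move=> mX mY; apply: measurable_sum => i; exact: measurable_funM.
Qed.

Lemma measurable_enorm X : random_vector X ->
  measurable_fun setT (fun w => enorm (X w)).
Proof.
move=> mX; apply: (@measurableT_comp _ _ _ _ _ _ (@Num.sqrt R)).
  by apply: continuous_measurable_fun; exact: sqrt_continuous.
exact: measurable_dot.
Qed.

Lemma random_vector_grad (f : 'rV[R]_n -> R) X :
  continuous (grad f) -> random_vector X -> random_vector (grad f \o X).
Proof.
move=> cf mX i.
have ci : continuous (fun y => grad f y 0 i).
  move=> y; apply: (@continuous_comp _ _ _ (grad f) (fun v => v 0 i)).
    exact: cf.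
  exact: coord_continuous.
exact: measurable_continuous_comp mX ci.
Qed.

End measurability.

(** * The expected decrease in one iteration *)

Section conditional_moments.
Context {d : measure_display} {T : measurableType d} {R : realType} {n : nat}.
Variables (P : probability T R) (f : 'rV[R]_n -> R) (omega M1 M2 : R).
Variables (x g Eg : T -> 'rV[R]_n) (Eg2 : T -> R).
Hypothesis cf : continuous (grad f).
Hypotheses (M10 : 0 < M1) (M20 : 0 < M2).
Hypotheses (mx : random_vector x) (mg : random_vector g).
Hypothesis hEg : is_condexp_vec P (sigma_of x) g Eg.
Hypothesis hEg2 : is_condexp P (sigma_of x) (fun w => enorm (g w) ^+ 2) Eg2.
Hypothesis hdescent : {ae P, forall w,
  omega * enorm (grad f (x w)) ^+ 2 <= dot (grad f (x w)) (Eg w)}.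
Hypothesis hmoment : {ae P, forall w,
  Eg2 w <= M1 + M2 * enorm (grad f (x w)) ^+ 2}.

Local Notation integr X := (P.-integrable setT (EFin \o X)).
Local Notation TG := (g_sigma_algebraType (coordinate_preimages x)).

Let gradn w := enorm (grad f (x w)).

Hypothesis igrad : integr (fun w => gradn w ^+ 2).

Let subG : <<s coordinate_preimages x >> `<=` measurable.
Proof. exact: sigma_of_sub. Qed.

Let mgradG : random_vector (grad f \o x : TG -> 'rV[R]_n).
Proof. by apply: random_vector_grad => //; exact: random_vector_sigma_of. Qed.

Let mgradnG : measurable_fun setT (gradn : TG -> R).
Proof. exact: (measurable_enorm (grad f \o x : TG -> 'rV[R]_n)). Qed.

Let mgradn : measurable_fun setT gradn.
Proof. exact: sub_measurable_fun mgradnG. Qed.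

Let ig2 : integr (fun w => enorm (g w) ^+ 2).
Proof. by case: hEg2. Qed.

Lemma integrable_gradn_enorm : integr (fun w => gradn w * enorm (g w)).
Proof.
apply: (integrable_le _ _ (fun w => gradn w ^+ 2 + enorm (g w) ^+ 2)).
- by apply: measurable_funM => //; exact: measurable_enorm.
- move=> w; rewrite ger0_norm ?mulr_ge0 ?enorm_ge0//.
  have := sqr_ge0 (gradn w - enorm (g w)).
  have := mulr_ge0 (enorm_ge0 (grad f (x w))) (enorm_ge0 (g w)).
  by rewrite -/(gradn w); nra.
- exact: integrable_addr.
Qed.

Lemma integrable_dot_grad : integr (fun w => dot (grad f (x w)) (g w)).
Proof.
apply: integrable_le integrable_gradn_enorm.
- apply: (measurable_dot (grad f \o x) g) => //.
  exact: random_vector_grad.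
- by move=> w; exact: cauchy_schwarz.
Qed.

(** The coordinates of [grad f (x w)] are [sigma_of x]-measurable weights on those of [g], so
    [hdescent] can be integrated. *)
Lemma expectation_dot_grad_ge :
  omega * \int[P]_w gradn w ^+ 2 <= \int[P]_w dot (grad f (x w)) (g w).
Proof.
rewrite -RintegralZl//.
apply: (condexp_weighted_ge P _ subG _ (fun i w => grad f (x w) 0 i)
  (fun i w => g w 0 i) (fun i w => Eg w 0 i)) => //.
- exact: integrable_scaler.
- exact: integrable_dot_grad.
Qed.

Lemma expectation_sqr_enorm_le :
  \int[P]_w enorm (g w) ^+ 2 <= M1 + M2 * \int[P]_w gradn w ^+ 2.
Proof.
have iV : integr (fun w => M1 + M2 * gradn w ^+ 2).
  by apply: integrable_addr; [exact: integrable_cstr|exact: integrable_scaler].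
have -> : \int[P]_w enorm (g w) ^+ 2 = \int[P]_w (1 * enorm (g w) ^+ 2).
  by apply: eq_Rintegral => w _; rewrite mul1r.
apply: (@le_trans _ _ (\int[P]_w (M1 + M2 * gradn w ^+ 2))).
  apply: (condexp_weighted_le P _ subG _ _ Eg2) => //.
  - by apply: filterS hmoment => w; rewrite mul1r.
  - exact: integrable_scaler.
by rewrite Rintegral_affine.
Qed.

(* Young's inequality [G N <= G t / 2 + (G / (2 t)) N^2] with
   [t = sqrt M1 + sqrt M2 * G] replaces the conditional Jensen inequality: the
   weight [G / (2 t)] is bounded and [sigma_of x]-measurable, and
   [E(N^2 | x) <= t^2]. *)
Lemma expectation_gradn_enorm_le :
  \int[P]_w (gradn w * enorm (g w))
  <= Num.sqrt M1 / 2 + (Num.sqrt M1 / 2 + Num.sqrt M2) * \int[P]_w gradn w ^+ 2.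
Proof.
set s1 := Num.sqrt M1; set s2 := Num.sqrt M2.
have s10 : 0 < s1 by rewrite sqrtr_gt0.
have s20 : 0 < s2 by rewrite sqrtr_gt0.
pose t w := s1 + s2 * gradn w.
have G0 w : 0 <= gradn w := enorm_ge0 _.
have t0 w : 0 < t w by rewrite ltr_pwDl// mulr_ge0// ltW.
pose kappa w := gradn w / (2 * t w).
have kappa0 w : 0 <= kappa w by rewrite divr_ge0// mulr_ge0// ltW.
have mkappa : measurable_fun setT (kappa : TG -> R).
  (* The absolute value keeps the denominator positive on the whole line, so [k] is continuous
     everywhere. *)
  pose k (u : R) := u / (2 * (s1 + s2 * `|u|)).
  have -> : kappa = k \o gradn.
    by apply/funext => w; rewrite /k /kappa /= ger0_norm.
  apply: measurableT_comp => //; apply: continuous_measurable_fun => u.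
  apply: cvgM; first exact: cvg_id.
  apply: cvgV.
    by rewrite gt_eqF// mulr_gt0// ltr_pwDl// mulr_ge0// ltW.
  apply: cvgM; first exact: cvg_cst.
  apply: cvgD; first exact: cvg_cst.
  apply: cvgM; first exact: cvg_cst.
  exact: norm_continuous.
have iV : integr (fun w => s1 / 2 + (s1 / 2 + s2) * gradn w ^+ 2).
  by apply: integrable_addr; [exact: integrable_cstr|exact: integrable_scaler].
(* From [gradn w <= (1 + gradn w ^+ 2) / 2]; this is the origin of the constants [h1] and [h2]. *)
have GtV w : gradn w * t w <= s1 / 2 + (s1 / 2 + s2) * gradn w ^+ 2.
  have := sqr_ge0 (gradn w - 1); rewrite /t; nra.
have Gt0 w : 0 <= gradn w * t w by rewrite mulr_ge0// ltW.
have iGt : integr (fun w => gradn w * t w).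
  apply: integrable_le iV.
    apply: measurable_funM => //; apply: measurable_funD => //.
    exact: measurable_funM.
  by move=> w; rewrite ger0_norm.
have iGt2 : integr (fun w => 2^-1 * (gradn w * t w)).
  exact: integrable_scaler.
have ikN : integr (fun w => kappa w * enorm (g w) ^+ 2).
  (* Since [t w >= s2 * gradn w], the weight [kappa] is at most [(2 * s2)^-1]. *)
  apply: (integrable_boundedM _ (2 * s2)^-1) => //.
    exact: sub_measurable_fun mkappa.
  move=> w; rewrite ger0_norm// ler_pdivrMr ?mulr_gt0//.
  rewrite ler_pdivlMl ?mulr_gt0// /t; have := G0 w; nra.
have young w : gradn w * enorm (g w)
    <= 2^-1 * (gradn w * t w) + kappa w * enorm (g w) ^+ 2.
  have -> : 2^-1 * (gradn w * t w) + kappa w * enorm (g w) ^+ 2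
      = gradn w * enorm (g w) + kappa w * (t w - enorm (g w)) ^+ 2.
    by rewrite /kappa; field; rewrite gt_eqF.
  by rewrite lerDl mulr_ge0// sqr_ge0.
have le1 := le_Rintegral measurableT integrable_gradn_enorm
  (integrable_addr _ _ _ iGt2 ikN) (fun w _ => young w).
rewrite RintegralD// in le1.
have le2 : \int[P]_w (kappa w * enorm (g w) ^+ 2)
    <= \int[P]_w (2^-1 * (gradn w * t w)).
  apply: (condexp_weighted_le P _ subG _ _ Eg2) => //.
  apply: filterS hmoment => w hw.
  (* Expanding the square, [t w ^+ 2] exceeds [M1 + M2 * gradn w ^+ 2] by the cross term; moreover
     [kappa w * t w ^+ 2] is half of [gradn w * t w]. *)
  apply: (@le_trans _ _ (kappa w * t w ^+ 2)).
    rewrite ler_wpM2l// (le_trans hw)// /t.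
    rewrite -[X in X + _ <= _](sqr_sqrtr (ltW M10)).
    rewrite -[X in _ + X * _ <= _](sqr_sqrtr (ltW M20)) -/s1 -/s2 -/(gradn w).
    have := mulr_ge0 (mulr_ge0 (ltW s10) (ltW s20)) (G0 w).
    by nra.
  rewrite le_eqVlt; apply/orP; left; apply/eqP.
  by rewrite /kappa; field; rewrite gt_eqF.
rewrite RintegralZl// in le1 le2.
apply: (@le_trans _ _ (\int[P]_w (gradn w * t w))); first lra.
apply: (le_trans (le_Rintegral measurableT iGt iV (fun w _ => GtV w))).
by rewrite Rintegral_affine.
Qed.

End conditional_moments.

Section one_step.
Context {d : measure_display} {T : measurableType d} {R : realType} {n : nat}.
Variables (P : probability T R) (f : 'rV[R]_n -> R).
Variables (fstar L omega M1 M2 m A : R).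
Variables (x g Eg x' : T -> 'rV[R]_n) (Eg2 s : T -> R).
Hypotheses (fC1 : continuously_differentiable f).
Hypotheses (fstar_le : forall y, fstar <= f y) (L0 : 0 < L).
Hypothesis smooth : forall y z,
  f y <= f z + dot (grad f z) (y - z) + L / 2 * enorm (y - z) ^+ 2.
Hypotheses (M10 : 0 < M1) (M20 : 0 < M2).
Hypotheses (mx : random_vector x) (mg : random_vector g).
Hypothesis mx' : random_vector x'.
Hypothesis hEg : is_condexp_vec P (sigma_of x) g Eg.
Hypothesis hEg2 : is_condexp P (sigma_of x) (fun w => enorm (g w) ^+ 2) Eg2.
Hypothesis hdescent : {ae P, forall w,
  omega * enorm (grad f (x w)) ^+ 2 <= dot (grad f (x w)) (Eg w)}.
Hypothesis hmoment : {ae P, forall w,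
  Eg2 w <= M1 + M2 * enorm (grad f (x w)) ^+ 2}.
Hypotheses (m0 : 0 <= m) (mA : m <= A) (sA : forall w, m <= s w <= A).
Hypothesis x'E : forall w, x' w = x w + (- s w) *: g w.

Local Notation integr X := (P.-integrable setT (EFin \o X)).

Hypothesis ifx : integr (f \o x).

Let cf : continuous f.
Proof. by move=> y; apply: differentiable_continuous; case: fC1. Qed.

Let cgrad : continuous (grad f). Proof. by case: fC1. Qed.

Lemma integrable_sqr_grad : integr (fun w => enorm (grad f (x w)) ^+ 2).
Proof.
apply: (integrable_le _ _ (fun w => 2 * L * (f (x w) - fstar))).
- apply: measurable_funX; apply: (measurable_enorm (grad f \o x)).
  exact: random_vector_grad.
- by move=> w; rewrite ger0_norm ?sqr_ge0//; exact: sqr_enorm_grad_le.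
- apply: integrable_scaler; apply: integrable_subr => //.
  exact: integrable_cstr.
Qed.

(** Integrates [step_le] and inserts the three moment bounds. Integrability of [f \o x'] follows
    since it lies between [fstar] and the integrable [B]; it lets the estimate be iterated. *)
Lemma one_step_expectation :
  integr (f \o x') /\
  \int[P]_w f (x' w) <= \int[P]_w f (x w)
    + (A - m) * (Num.sqrt M1 / 2) + L / 2 * A ^+ 2 * M1
    - (A * omega - (A - m) * (Num.sqrt M1 / 2 + Num.sqrt M2)
       - L / 2 * A ^+ 2 * M2) * \int[P]_w enorm (grad f (x w)) ^+ 2.
Proof.
pose B w := f (x w) - A * dot (grad f (x w)) (g w)
    + (A - m) * (enorm (grad f (x w)) * enorm (g w))
    + L / 2 * A ^+ 2 * enorm (g w) ^+ 2.
have leB w : f (x' w) <= B w by rewrite x'E; exact: step_le.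
have igrad := integrable_sqr_grad.
have iag : integr (fun w => dot (grad f (x w)) (g w)).
  exact: integrable_dot_grad hEg2 igrad.
have iGN : integr (fun w => enorm (grad f (x w)) * enorm (g w)).
  exact: integrable_gradn_enorm hEg2 igrad.
have ig2 : integr (fun w => enorm (g w) ^+ 2) by case: hEg2.
have i1 : integr (fun w => f (x w) - A * dot (grad f (x w)) (g w)).
  by apply: integrable_subr => //; exact: integrable_scaler.
have i2 : integr (fun w => (A - m) * (enorm (grad f (x w)) * enorm (g w))).
  exact: integrable_scaler.
have i3 : integr (fun w => L / 2 * A ^+ 2 * enorm (g w) ^+ 2).
  exact: integrable_scaler.
have i12 := integrable_addr _ _ _ i1 i2.
have iB : integr B by exact: integrable_addr.
have ifx' : integr (f \o x').
  apply: (integrable_le _ _ (fun w => `|fstar| + `|B w|)).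
  - exact: measurable_continuous_comp.
  - move=> w; rewrite /= ler_norml; apply/andP; split.
      apply: le_trans (fstar_le _); apply: (@le_trans _ _ (- `|fstar|)).
        by rewrite lerN2 lerDl.
      by rewrite lerNl -normrN ler_norm.
    by apply: le_trans (leB w) _; rewrite (le_trans (ler_norm _))// lerDr.
  - by apply: integrable_addr; [exact: integrable_cstr|exact: integrable_norm].
split => //.
apply: le_trans (le_Rintegral measurableT ifx' iB (fun w _ => leB w)) _.
rewrite RintegralD// RintegralD// RintegralB//; last exact: integrable_scaler.
rewrite !RintegralZl//.
have hdot := expectation_dot_grad_ge _ _ _ _ _ _ _
  cgrad mx mg hEg hEg2 hdescent igrad.
have hmix := expectation_gradn_enorm_le _ _ _ _ _ _ _
  cgrad M10 M20 mx mg hEg2 hmoment igrad.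
have hsqr := expectation_sqr_enorm_le _ _ _ _ _ _ _ mx hEg2 hmoment igrad.
have {}hdot := ler_wpM2l (le_trans m0 mA) hdot.
have Am : 0 <= A - m by rewrite subr_ge0.
have {}hmix := ler_wpM2l Am hmix.
have LA : 0 <= L / 2 * A ^+ 2 by rewrite mulr_ge0 ?sqr_ge0// divr_ge0// ltW.
have {}hsqr := ler_wpM2l LA hsqr.
lra.
Qed.

End one_step.

(** * The recursion for the expected gap and its limit *)

(** [b / q] is the fixed point of the affine recursion, and the deviation from it contracts by the
    nonnegative factor [1 - q]. *)
Lemma geometric_recursion_le {R : realFieldType} (q b : R) (e : nat -> R) :
  0 < q <= 1 -> (forall k, e k.+1 <= (1 - q) * e k + b) ->
  forall k, e k <= b / q + (1 - q) ^+ k * (e 0 - b / q).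
Proof.
move=> /andP[q0 q1] he; elim=> [|k IHk]; first by rewrite expr0 mul1r subrKC.
apply: le_trans (he k) _; rewrite exprS -mulrA.
have -> : b / q + (1 - q) * ((1 - q) ^+ k * (e 0 - b / q))
    = (1 - q) * (b / q + (1 - q) ^+ k * (e 0 - b / q)) + b.
  by field; rewrite gt_eqF.
by rewrite lerD2r ler_wpM2l// subr_ge0.
Qed.

(** The assumptions bound the moments from one side only, so the gap itself may stay below
    [limit_gap]. The convergence is therefore that of an explicit upper bound on the gap. *)
Theorem theorem3p1
  (R : realType) (d : measure_display) (T : measurableType d)
  (P : probability T R) (n N : nat)
  (fs : 'I_N -> 'rV[R]_n -> R) (fstar L c omega M1 M2 : R)
  (alpha gamma1 gamma2 mumin mu0 : R) (x0 : 'rV[R]_n)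
  (x g p : nat -> T -> 'rV[R]_n) (mu : nat -> T -> R)
  (Eg : nat -> T -> 'rV[R]_n) (Eg2 : nat -> T -> R)
  (f := finite_sum_objective fs)
  (hN : (0 < N)%N)
  (hfs : forall i, continuously_differentiable (fs i))
  (halpha : 0 < alpha) (hgamma2 : 0 < gamma2) (hgamma12 : gamma2 <= gamma1)
  (hmumin : 0 < mumin) (hmu0 : 0 < mu0)
  (hrun : TRishBB_run alpha gamma1 gamma2 mumin mu0 x0 x g p mu)
  (hfC1 : continuously_differentiable f)
  (hfstar : forall y, fstar <= f y)
  (hL0 : 0 < L)
  (hL : forall y z,
    f y <= f z + dot (grad f z) (y - z) + L / 2 * enorm (y - z) ^+ 2)
  (hc0 : 0 < c)
  (hPL : forall y, 2 * c * (f y - fstar) <= enorm (grad f y) ^+ 2)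
  (homega : 0 < omega) (hM1 : 0 < M1) (hM2 : 0 < M2)
  (hEg : forall k, is_condexp_vec P (sigma_of (x k)) (g k) (Eg k))
  (hEg2 : forall k,
    is_condexp P (sigma_of (x k)) (fun w => enorm (g k w) ^+ 2) (Eg2 k))
  (hdescent : forall k, {ae P, forall w,
    omega * enorm (grad f (x k w)) ^+ 2 <= dot (grad f (x k w)) (Eg k w)})
  (hmoment : forall k, {ae P, forall w,
    Eg2 k w <= M1 + M2 * enorm (grad f (x k w)) ^+ 2})
  (hmumin_le : mumin <= gamma2 * alpha)
  (h1 := Num.sqrt M1 / 2)
  (h2 := h1 + Num.sqrt M2)
  (rho := mumin / (alpha * gamma2))
  (theta1 := omega * gamma1 / 2 - h2 * (gamma1 - rho * gamma2))
  (theta2 := h1 * (gamma1 * alpha - mumin)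
             + gamma1 ^+ 2 * L * M1 * alpha ^+ 2 / 2)
  (hratio : 0 < h2 - omega / 2 ->
    gamma1 / gamma2 < rho * h2 / (h2 - omega / 2))
  (halpha_le :
    alpha <= Num.min (omega / (gamma1 * L * M2)) (1 / (2 * c * theta1)))
  (limit_gap := theta2 / (2 * c * alpha * theta1))
  (gap_bound := fun k : nat => limit_gap
     + (1 - 2 * c * alpha * theta1) ^+ k.+1 * (f x0 - fstar - limit_gap)) :
  (forall k : nat,
     ('E_P[fun w => f (x k.+1 w)] - fstar%:E <= (gap_bound k)%:E)%E) /\
  gap_bound @ \oo --> limit_gap.
Proof.
have hgamma1 : 0 < gamma1 by exact: lt_le_trans hgamma12.
have h10 : 0 < h1 by rewrite divr_gt0// sqrtr_gt0.
have h20 : 0 < h2 by rewrite addr_gt0// sqrtr_gt0.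
have alphaE : alpha * gamma2 * rho = mumin.
  by rewrite mulrC divfK// gt_eqF// mulr_gt0.
have rho0 : 0 < rho by rewrite divr_gt0// mulr_gt0.
(* [theta1 = gamma1 * (omega / 2 - h2) + h2 * rho * gamma2]: the ratio condition says this is
   positive when the first term is negative. *)
have theta10 : 0 < theta1.
  have [hpos|hneg] := ltP 0 (h2 - omega / 2).
    have := hratio hpos.
    rewrite ltr_pdivrMr// mulrAC ltr_pdivlMr// /theta1; lra.
  have := ler_wpM2l (ltW hgamma1) hneg.
  have := mulr_gt0 (mulr_gt0 rho0 h20) hgamma2.
  by rewrite /theta1; lra.
have /andP[alpha_le1 alpha_le2] : (alpha <= omega / (gamma1 * L * M2))
    && (alpha <= 1 / (2 * c * theta1)) by rewrite -le_min.
have ct0 : 0 < 2 * c * theta1 by rewrite !mulr_gt0.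
pose q := 2 * c * alpha * theta1.
have q01 : 0 < q <= 1.
  rewrite /q !mulr_gt0//=.
  by move: alpha_le2; rewrite ler_pdivlMr//; lra.
have /andP[q0 q1] := q01.
have mA : mumin <= gamma1 * alpha.
  by rewrite (le_trans hmumin_le)// ler_pM2r.
have [mx mg _ x0E _ mu_ge run_p x_step] := hrun.
have step k w := solves_tr_step _ _ _ halpha hgamma2 hgamma12 _ _ _ _
  hmumin (mu_ge k w) hmumin_le (run_p k w).
(* A step size is chosen outcome by outcome; only its range and the update formula are used. *)
pose s k w := sval (cid2 (step k w)).
have sA k w : mumin <= s k w <= gamma1 * alpha by rewrite /s; case: cid2.
have xE k w : x k.+1 w = x k w + (- s k w) *: g k w.
  by rewrite x_step /s; case: cid2 => /= t _ ->.
have cf : continuous f.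
  by move=> y; apply: differentiable_continuous; case: hfC1.
have one k := one_step_expectation P f fstar L omega M1 M2 mumin
  (gamma1 * alpha) (x k) (g k) (Eg k) (x k.+1) (Eg2 k) (s k) hfC1 hfstar hL0
  hL hM1 hM2 (mx k) (mg k) (mx k.+1) (hEg k) (hEg2 k) (hdescent k) (hmoment k)
  (ltW hmumin) mA (sA k) (xE k).
(* Integrability starts from the deterministic [x0] and passes along the iterates through [one]. *)
have ifx k : P.-integrable setT (EFin \o (f \o x k)).
  elim: k => [|k /one []//].
  rewrite (_ : f \o x 0 = fun=> f x0); first exact: integrable_cstr.
  by apply/funext => w; rewrite /= x0E.
pose e k := \int[P]_w f (x k w) - fstar.
have eE k : e k = \int[P]_w (- fstar + 1 * f (x k w)).
  by rewrite (Rintegral_affine _ _ _ (f \o x k))// mul1r addrC.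
have igap k : P.-integrable setT (EFin \o (fun w => - fstar + 1 * f (x k w))).
  apply: integrable_addr; first exact: integrable_cstr.
  exact: (integrable_scaler _ _ _ (ifx k)).
have e0 : e 0 = f x0 - fstar.
  rewrite /e; under eq_Rintegral do rewrite x0E.
  rewrite Rintegral_cst//.
  have /(congr1 fine) -> := @probability_setT _ _ _ P.
  by rewrite mulr1.
have erec k : e k.+1 <= (1 - q) * e k + theta2.
  have [_] := one k (ifx k).
  set EG := \int[P]_w enorm _ ^+ 2.
  have EG_ge : 2 * c * e k <= EG.
    rewrite eE -RintegralZl//; apply: le_Rintegral => //.
    - exact: (integrable_scaler _ _ _ (igap k)).
    - exact: (integrable_sqr_grad P f fstar L).
    - by move=> w _; rewrite mul1r addrC; exact: hPL.
  (* The first bound on [alpha] makes the quadratic term at most half of [gamma1 * alpha * omega];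
     what remains is [alpha * theta1]. *)
  have coef : alpha * theta1 <= gamma1 * alpha * omega
      - (gamma1 * alpha - mumin) * h2 - L / 2 * (gamma1 * alpha) ^+ 2 * M2.
    move: alpha_le1; rewrite ler_pdivlMr ?mulr_gt0// => alpha_le1.
    have := ler_wpM2l (ltW (mulr_gt0 hgamma1 halpha)) alpha_le1.
    by rewrite /theta1 -[in X in _ -> _ <= X]alphaE; lra.
  have at0 : 0 <= alpha * theta1 by rewrite mulr_ge0// ltW.
  (* The Polyak-Lojasiewicz bound turns [alpha * theta1 * EG] into a decrease of at least
     [q * e k]. *)
  have := ler_wpM2l at0 EG_ge.
  have EG0 : 0 <= EG by apply: Rintegral_ge0 => w _; exact: sqr_ge0.
  have := ler_wpM2r EG0 coef.
  rewrite -/h1 -/h2 /e /theta2 /q; lra.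
split=> [k|].
  have -> : ('E_P[fun w => f (x k.+1 w)] = (\int[P]_w f (x k.+1 w))%R%:E)%E.
    by rewrite unlock /Rintegral fineK//; exact: integrable_fin_num (ifx k.+1).
  rewrite -EFinB lee_fin.
  have := geometric_recursion_le q theta2 e q01 erec k.+1.
  by rewrite e0.
rewrite -[X in _ --> X](addr0 limit_gap).
apply: cvgD; first exact: cvg_cst.
rewrite -[X in _ --> X](mul0r (f x0 - fstar - limit_gap)).
apply: cvgM; last exact: cvg_cst.
have : (GRing.exp (1 - q) : R^nat) @ \oo --> 0.
  by apply: cvg_expr; rewrite ger0_norm ?subr_ge0// gtrBl.
by rewrite -cvg_shiftS.
Qed.
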